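(* Let $G=(V,\vec E,b)$ be an infinite directed weighted graph with vertex measure $m$ satisfying the standing assumptions listed in the context (including Assumption $(\beta)$), and let $\{G_n=(V_n,\vec E_n)\}_{n\in\mathbb N}$ be a filtration of $G$. Suppose that $G$ has heavy ends, i.e. $m_\infty=\infty$, and that $\tilde h_\infty>0$. Then the essential spectrum of $\overline\Delta$ (the closure in $\ell^2(V,m)$ of the Laplacian $\Delta$ defined on $\mathcal C_c(V)$) is empty: $\sigma_{ess}(\overline\Delta)=\emptyset$.
   Context: A directed weighted graph is $G=(V,\vec E,b)$ with $V$ a countable vertex set and $b:V\times V\to[0,\infty)$ satisfying $b(x,x)=0$ for all $x$ and $b(x,y)>0$ iff $(x,y)\in\vec E$; it carries a measure $m:V\to(0,\infty)$. Put $\beta^+(x)=\sum_{y\in V}b(x,y)$ and $\beta^-(x)=\sum_{y\in V}b(y,x)$. Standing assumptions: $G$ is locally finite (each $x$ has only finitely many $y$ with $b(x,y)>0$ or $b(y,x)>0$); $\beta^+(x)>0$ and $\beta^-(x)>0$ for all $x$; Assumption $(\beta)$: $\beta^+(x)=\beta^-(x)$ for all $x\in V$; $G$ is connected, i.e. any two distinct vertices are related by a path, in one of the two directions (a path from $x$ to $y$ is a finite sequence of directed edges $(x_1,y_1),\dots,(x_n,y_n)\in\vec E$, $n\ge2$, with $x_1=x$, $y_n=y$, $x_i=y_{i-1}$ for $2\le i\le n$). $\mathcal C_c(V)$ is the space of finitely supported functions $V\to\mathbb C$; $\ell^2(V,m)$ has inner product $(f,g)_m=\sum_x m(x)f(x)\overline{g(x)}$.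 The Laplacian on $\mathcal C_c(V)$ is $\Delta f(x)=\frac1{m(x)}\sum_{y}b(x,y)(f(x)-f(y))$. It is closable; its closure $\overline\Delta$ has domain the set of $f\in\ell^2(V,m)$ for which there are $f_n\in\mathcal C_c(V)$ with $f_n\to f$ and $\Delta f_n$ convergent in $\ell^2(V,m)$, and $\overline\Delta f=\lim\Delta f_n$. The essential spectrum $\sigma_{ess}(A)$ of a closed operator $A$ is the set of $\lambda\in\mathbb C$ such that the range of $A-\lambda$ is not closed or $\dim\ker(A-\lambda)=\infty$. For $\Omega\subset V$ non-empty: $m_\Omega=\inf_{x\in\Omega}\beta^+(x)/m(x)$ and $$\tilde h(\Omega)=\inf_U\frac{b(\partial_EU)}{\beta^+(U)},$$ infimum over non-empty finite $U\subset\Omega$, where $\partial_E U=\{(x,y)\in\vec E: (x\in U,y\in U^c)\text{ or }(x\in U^c,y\in U)\}$, $b(\partial_EU)=\sum_{(x,y)\in\partial_EU}b(x,y)$, $\beta^+(U)=\sum_{x\in U}\beta^+(x)$. A subgraph of $G$ is given by a subset $V_H\subset V$ of vertices with edge set $\vec E\cap(V_H\times V_H)$. A filtration of $G$ is a sequence of finite connected subgraphs $G_n=(V_n,\vec E_n)$ with $G_n\subset G_{n+1}$ and $\bigcup_n V_n=V$. Then $m_\infty=\lim_n m_{V_n^c}\in[0,\infty]$ and $\tilde h_\infty=\lim_n\tilde h(V_n^c)$ (monotone limits). *)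

(* Defs.v *)
From HB Require Import structures.
From mathcomp Require Import all_boot all_order all_algebra finmap ring.
From mathcomp Require Import all_classical all_reals all_analysis.
From mathcomp Require Export complex.

Set Implicit Arguments.
Unset Strict Implicit.
Unset Printing Implicit Defensive.

Import Order.TTheory GRing.Theory Num.Theory.
Import numFieldNormedType.Exports.

Local Open Scope classical_set_scope.
Local Open Scope ring_scope.
Local Open Scope complex_scope.

Record wdigraph (R : realType) (V : countType) := WDigraph {
  edges : set (V * V);
  weight : V -> V -> R;
  weight_ge0 : forall x y, 0 <= weight x y;
  weight_loop : forall x, weight x x = 0;
  edgesP : forall x y, 0 < weight x y <-> edges (x, y) }.

Section Graph.
Variables (R : realType) (V : countType) (G : wdigraph R V).
Local Notation b := (weight G).

Definition locally_finite :=
  forall x, finite_set [set y | 0 < b x y \/ 0 < b y x].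

(* Finitely supported sums: [\sum_(y \in A) F y] is 0 when F has infinite
   support in A, which cannot happen below under [locally_finite]. *)
Definition beta_out (x : V) : R := \sum_(y \in [set: V]) b x y.
Definition beta_in (x : V) : R := \sum_(y \in [set: V]) b y x.

Definition assumption_beta := forall x, beta_out x = beta_in x.

(* The edges of the path are e :: s, so that there are at least two. *)
Definition has_path (E : set (V * V)) (x y : V) :=
  exists (e : V * V) (s : seq (V * V)),
    [/\ (2 <= size (e :: s))%N,
        (forall e', e' \in e :: s -> E e'),
        path (fun e1 e2 => e1.2 == e2.1) e s,
        e.1 = x & (last e s).2 = y].

(* Connectedness of the graph with vertex set W and edge set E. *)
Definition connected_graph (W : set V) (E : set (V * V)) :=
  forall x y, W x -> W y -> x <> y -> has_path E x y \/ has_path E y x.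

Definition subgraph_edges (W : set V) : set (V * V) := edges G `&` (W `*` W).

Definition filtration (W : nat -> set V) :=
  [/\ forall n, finite_set (W n),
      forall n, connected_graph (W n) (subgraph_edges (W n)),
      forall n, W n `<=` W n.+1
    & \bigcup_n W n = [set: V]].

Definition edge_boundary (U : set V) : set (V * V) :=
  [set e | edges G e /\ ((U e.1 /\ ~ U e.2) \/ (~ U e.1 /\ U e.2))].

Definition boundary_weight (U : set V) : R :=
  \sum_(e \in edge_boundary U) b e.1 e.2.

Definition beta_out_set (U : set V) : R := \sum_(x \in U) beta_out x.

Definition cheeger (Omega : set V) : \bar R :=
  ereal_inf [set (boundary_weight U / beta_out_set U)%:E | U in
    [set U | [/\ U !=set0, finite_set U & U `<=` Omega]]].

Definition cheeger_infty (W : nat -> set V) : \bar R :=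
  limn (fun n => cheeger (~` W n)).

Definition min_degree (m : V -> R) (Omega : set V) : \bar R :=
  ereal_inf [set (beta_out x / m x)%:E | x in Omega].

Definition min_degree_infty (m : V -> R) (W : nat -> set V) : \bar R :=
  limn (fun n => min_degree m (~` W n)).

Lemma is_cvg_cheeger W : filtration W -> cvgn (fun n => cheeger (~` W n)).
Proof.
case=> _ _ WS _; apply: ereal_nondecreasing_is_cvgn.
apply/nondecreasing_seqP => n; apply: ereal_inf_le_tmp; apply: image_subset.
by move=> U [U0 Uf UW]; split => // x /UW /= nWx /WS.
Qed.

Lemma is_cvg_min_degree m W :
  filtration W -> cvgn (fun n => min_degree m (~` W n)).
Proof.
case=> _ _ WS _; apply: ereal_nondecreasing_is_cvgn.
apply/nondecreasing_seqP => n; apply: ereal_inf_le_tmp; apply: image_subset.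
by move=> x /= nWx /WS.
Qed.

End Graph.

Section Ell2.
Variables (R : realType) (V : countType) (m : V -> R).
Local Notation F := (V -> R[i]).

Definition finitely_supported (f : F) := finite_set [set x | f x != 0].

Definition l2_sqnorm (f : F) : \bar R :=
  \esum_(x in [set: V]) (m x * Normc.normc (f x) ^+ 2)%:E.

Definition l2 : set F := [set f | (l2_sqnorm f < +oo)%E].

Definition l2_cvg (u : nat -> F) (f : F) :=
  l2_sqnorm (u n - f) @[n --> \oo] --> 0%E.

Definition l2_closed (S : set F) :=
  forall g, l2 g ->
    (forall e : R, 0 < e -> exists2 h, S h & (l2_sqnorm (h - g)%R < e%:E)%E) ->
    S g.

Definition linearly_independent (n : nat) (e : 'I_n -> F) :=
  forall c : 'I_n -> R[i], \sum_(i < n) c i *: e i = 0 -> forall i, c i = 0.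

Definition infinite_dim (S : set F) :=
  forall n, exists2 e : 'I_n -> F,
    forall i, S (e i) & linearly_independent e.

(* An operator A in l2(V, m) is represented by its graph: [A f g] means that f
   lies in the domain of A and A f = g. *)
Definition shifted_range (A : F -> F -> Prop) (lambda : R[i]) : set F :=
  [set g | exists f h, A f h /\ g = h - lambda *: f].

Definition shifted_kernel (A : F -> F -> Prop) (lambda : R[i]) : set F :=
  [set f | exists2 h, A f h & h - lambda *: f = 0].

Definition ess_spectrum (A : F -> F -> Prop) : set R[i] :=
  [set lambda | ~ l2_closed (shifted_range A lambda)
              \/ infinite_dim (shifted_kernel A lambda)].

End Ell2.

Section Laplacian.
Variables (R : realType) (V : countType) (G : wdigraph R V) (m : V -> R).
Local Notation F := (V -> R[i]).

Definition laplacian (f : F) : F := fun x =>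
  ((m x)^-1)%:C * \sum_(y \in [set: V]) (weight G x y)%:C * (f x - f y).

(* Graph of the closure of the Laplacian on finitely supported functions; see
   [laplacian_closure_fun] for its being single-valued. *)
Definition laplacian_closure (f g : F) :=
  [/\ l2 m f, l2 m g &
      exists u : nat -> F,
        [/\ forall n, finitely_supported (u n),
            l2_cvg m u f & l2_cvg m (fun n => laplacian (u n)) g]].

Lemma l2_cvg_pointwise (u : nat -> F) f x : (forall x, 0 < m x) ->
  l2_cvg m u f -> Normc.normc (u n x - f x) @[n --> \oo] --> (0 : R).
Proof.
move=> m0 uf.
have ge0 y (h : F) : (0 <= (m y * Normc.normc (h y) ^+ 2)%:E)%E.
  by rewrite lee_fin mulr_ge0 ?sqr_ge0 ?ltW.
have le1 (h : F) : ((m x * Normc.normc (h x) ^+ 2)%:E <= l2_sqnorm m h)%E.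
  apply: esum_ge; exists [set x] => //.
  by rewrite fsbig_set1.
have c1 : (m x * Normc.normc (u n x - f x) ^+ 2)%:E @[n --> \oo] --> 0%E.
  apply: (squeeze_cvge _ (@cvg_cst _ _ _ _ _) uf).
  by apply: nearW => n; rewrite (ge0 x (u n - f)) (le1 (u n - f)).
have c2 : m x * Normc.normc (u n x - f x) ^+ 2 @[n --> \oo] --> (0 : R).
  by have /fine_cvgP[] := c1.
have c3 : Num.sqrt ((m x)^-1 * (m x * Normc.normc (u n x - f x) ^+ 2))
    @[n --> \oo] --> Num.sqrt ((m x)^-1 * 0).
  apply: (@continuous_cvg _ _ _ _ _ _ (@Num.sqrt R)); first exact: sqrt_continuous.
  by apply: cvgMl_tmp.
move: c3; rewrite mulr0 sqrtr0.
apply: cvg_trans; apply: near_eq_cvg; apply: nearW => n.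
rewrite mulrA mulVf ?gt_eqF// mul1r sqrtr_sqr ger0_norm//.
by case: (u n x - f x) => a c; exact: sqrtr_ge0.
Qed.

Lemma laplacian_closure_fun (f g g' : F) :
  (forall x, 0 < m x) -> locally_finite G ->
  laplacian_closure f g -> laplacian_closure f g' -> g = g'.
Proof.
move=> m0 lf [_ _ [u [_ uf ug]]] [_ _ [v [_ vf vg]]]; apply/funext => x.
pose N : R[i] -> R := @Normc.normc R.
have NB (z w : R[i]) : N (z - w) = N (w - z).
  by rewrite /N -(@normcN _ (z - w : R[i])) opprB.
have ND (z w : R[i]) : N (z + w) <= N z + N w by exact: le_normcD.
pose A := fset_set [set y | 0 < weight G x y \/ 0 < weight G y x].
have lapE (h : F) : laplacian h x =
    ((m x)^-1)%:C * \sum_(y <- A) (weight G x y)%:C * (h x - h y).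
  congr (_ * _); apply: fsbigTE => y; rewrite in_fset_set// notin_setE/= => nA.
  have [w0|w0] := ltP 0 (weight G x y); first by case: nA; left.
  by rewrite (le_anti (introT andP (conj w0 (weight_ge0 G x y)))) mul0r.
pose d n y := N (u n y - f y) + N (v n y - f y).
have d0 y : d n y @[n --> \oo] --> (0 : R).
  by rewrite -[X in _ --> X]addr0; apply: cvgD; apply: l2_cvg_pointwise.
pose c n := N (laplacian (u n) x - g x) + N (laplacian (v n) x - g' x)
  + N ((m x)^-1)%:C * \sum_(y <- A) N (weight G x y)%:C * (d n x + d n y).
have c0 : c n @[n --> \oo] --> (0 : R).
  rewrite -[X in _ --> X]addr0; apply: cvgD.
    by rewrite -[X in _ --> X]addr0; apply: cvgD;
      [exact: (l2_cvg_pointwise x m0 ug)|exact: (l2_cvg_pointwise x m0 vg)].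
  rewrite -[X in _ --> X](mulr0 (N ((m x)^-1)%:C)); apply: cvgMl_tmp.
  have E0 : (0 : R) = \sum_(y <- A) N (weight G x y)%:C * (0 + 0).
    by rewrite big1// => y _; rewrite addr0 mulr0.
  rewrite [X in _ --> X]E0.
  elim: (enum_fset A) => [|y s IH].
    by under eq_fun do rewrite big_nil; rewrite big_nil; exact: cvg_cst.
  under eq_fun do rewrite big_cons; rewrite big_cons.
  apply: cvgD; last exact: IH.
  by apply: cvgMl_tmp; apply: cvgD.
have le_c n : N (g x - g' x) <= c n.
  have -> : g x - g' x = (g x - laplacian (u n) x)
      + (laplacian (v n) x - g' x) + (laplacian (u n) x - laplacian (v n) x).
    ring.
  apply: (le_trans (ND _ _)); apply: lerD.
    by apply: (le_trans (ND _ _)); rewrite NB.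
  rewrite !lapE -mulrBr -sumrB /N Normc.normcM -/N.
  apply: ler_wpM2l; first exact: sqrtr_ge0.
  elim: (enum_fset A) => [|y s IH]; first by rewrite !big_nil /N Normc.normc0.
  rewrite !big_cons; apply: (le_trans (ND _ _)); apply: lerD => //.
  rewrite -mulrBr /N Normc.normcM -/N; apply: ler_wpM2l; first exact: sqrtr_ge0.
  have dP z : N (u n z - v n z) <= d n z.
    have -> : u n z - v n z = (u n z - f z) + (f z - v n z) by ring.
    by apply: (le_trans (ND _ _)); rewrite lerD2l NB.
  have -> : u n x - u n y - (v n x - v n y) = (u n x - v n x) + (v n y - u n y).
    ring.
  apply: (le_trans (ND _ _)); apply: lerD => //.
  by rewrite NB.
apply/eqP; rewrite -subr_eq0; apply/eqP/Normc.eq0_normc/le_anti/andP; split.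
  rewrite -(cvg_lim _ c0)//; apply: limr_ge; first by apply/cvg_ex; exists 0.
  exact: nearW.
by case: (g x - g' x) => p q; exact: sqrtr_ge0.
Qed.

End Laplacian.

(* Main.v *)
(* For f finitely supported off a finite set K, assumption (beta) gives
   Re (Delta f, f) = 1/2 sum b(x,y) |f x - f y|^2, and Cheeger's argument (coarea
   inequality for |f|^2, then AM-GM) bounds this below by
   h^2/8 sum beta |f|^2 >= (h^2/8) M ||f||^2, where h is a lower bound of the
   Cheeger constant and M of beta/m off K. Heavy ends let K be chosen such that
   h^2 M / 8 >= Re lambda + 1, whence ||f|| <= ||(Delta - lambda) f||. Such a bound
   off a finite set suffices: the range of the closure minus lambda is the closure
   of (Delta - lambda) C_c(V \ K), which lies in the range by completeness, plus
   the span of the finitely many (Delta - lambda) delta_x, x in K, hence closed;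
   and an element of the kernel vanishing on K is zero, so the kernel has
   dimension at most |K|. *)
Require Import Defs.
From HB Require Import structures.
From mathcomp Require Import all_boot all_order all_algebra.
From mathcomp Require Import finmap ring lra.
From mathcomp Require Import all_classical all_reals all_analysis.

Import Order.TTheory GRing.Theory Num.Theory.
Import numFieldNormedType.Exports.

Local Open Scope classical_set_scope.
Local Open Scope ring_scope.

Set Implicit Arguments.
Unset Strict Implicit.
Unset Printing Implicit Defensive.

(** * Squared modulus on the complex numbers and limits of Cauchy sequences *)

Section SquaredModulus.
Variable R : realType.
Implicit Types z w : R[i].

(** Valued in [R], so that [sqmodE] turns every estimate into a polynomial inequality in real and
    imaginary parts. *)
Definition sqmod z : R := Normc.normc z ^+ 2.

Lemma sqmodE z : sqmod z = complex.Re z ^+ 2 + complex.Im z ^+ 2.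
Proof. by case: z => a b; rewrite /sqmod/= sqr_sqrtr// addr_ge0// sqr_ge0. Qed.

Lemma sqmod_ge0 z : 0 <= sqmod z. Proof. exact: sqr_ge0. Qed.

Lemma sqmod0 : sqmod 0 = 0.
Proof. by rewrite /sqmod Normc.normc0 expr0n. Qed.

Lemma sqmodM z w : sqmod (z * w) = sqmod z * sqmod w.
Proof. by rewrite /sqmod Normc.normcM exprMn. Qed.

Lemma sqmodV z : sqmod z^-1 = (sqmod z)^-1.
Proof. by rewrite /sqmod Normc.normcV exprVn. Qed.

Lemma sqmodN z : sqmod (- z) = sqmod z.
Proof. by rewrite /sqmod normcN. Qed.

Lemma sqmod_eq0 z : (sqmod z == 0) = (z == 0).
Proof.
apply/idP/idP => [|/eqP->]; last by rewrite sqmod0.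
by rewrite sqrf_eq0 => /eqP/Normc.eq0_normc ->.
Qed.

Lemma sqmod_gt0 z : z != 0 -> 0 < sqmod z.
Proof. by move=> z0; rewrite lt0r sqmod_eq0 z0 sqmod_ge0. Qed.

(** Parallelogram law: the two sides differ by |z - w|^2. It replaces the triangle inequality below,
    so that no square root of a norm occurs, at the price of factors 2. *)
Lemma sqmodD_le z w : sqmod (z + w) <= 2 * sqmod z + 2 * sqmod w.
Proof.
rewrite !sqmodE; case: z => a b; case: w => c d /=.
by have := sqr_ge0 (a - c); have := sqr_ge0 (b - d); rewrite !expr2; lra.
Qed.

Lemma Re_mulJ_le z w :
  2 * complex.Re (z * (w^*)%C) <= sqmod z + sqmod w.
Proof.
rewrite !sqmodE; case: z => a b; case: w => c d /=.
by have := sqr_ge0 (a - c); have := sqr_ge0 (b - d); rewrite !expr2; lra.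
Qed.

Lemma Re_sum (I : Type) (r : seq I) (z : I -> R[i]) :
  complex.Re (\sum_(i <- r) z i) = \sum_(i <- r) complex.Re (z i).
Proof. by apply: (big_morph (@complex.Re R)) => // -[? ?] [? ?]. Qed.

Lemma Re_realM (k : R) (z : R[i]) :
  complex.Re (k%:C%C * z) = k * complex.Re z.
Proof. by case: z => p q; rewrite /= mul0r subr0. Qed.

(** Weighted AM-GM for u^2 - v^2 = (u - v)(u + v), applied to real and imaginary parts. The weight
    [t] stays free so that Cheeger's argument can tune it to the isoperimetric constant. *)
Lemma sqmod_sub_le t z w : 0 < t ->
  `|sqmod z - sqmod w| <=
  (2 * t)^-1 * sqmod (z - w) + t * (sqmod z + sqmod w) :> R.
Proof.
move=> t0; have t2 : 0 < 2 * t by rewrite mulr_gt0.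
rewrite -(ler_pM2l t2) mulrDr mulrA divff ?gt_eqF// mul1r.
rewrite -[X in X * `|_|](gtr0_norm t2) -normrM.
rewrite !sqmodE; case: z => p q; case: w => r s /=.
have amgm u v : 2 * t * (u ^+ 2 - v ^+ 2) <=
    (u - v) ^+ 2 + 2 * t * (t * (u ^+ 2 + v ^+ 2)).
  (* The right side minus the left side is exactly the sum of these two squares. *)
  have := sqr_ge0 ((u - v) - t * (u + v)); have := sqr_ge0 (t * (u - v)).
  rewrite -subr_ge0 => H1 H2; rewrite -subr_ge0; apply: le_trans (addr_ge0 H1 H2) _.
  by rewrite le_eqVlt; apply/orP; left; apply/eqP; ring.
rewrite ler_norml; apply/andP; split.
  by have := amgm r p; have := amgm s q; rewrite !expr2; lra.
by have := amgm p r; have := amgm q s; rewrite !expr2; lra.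
Qed.

Lemma harmonic_le (e : R) : 0 < e ->
  exists n0, forall n, (n0 <= n)%N -> n.+1%:R^-1 <= e.
Proof.
move=> e0; have /cvgrPdist_le/(_ _ e0)[n0 _ n0P] := @cvg_harmonic R.
by exists n0 => n /n0P; rewrite /= sub0r normrN ger0_norm ?invr_ge0.
Qed.

Lemma real_cauchy_cvg (u : nat -> R) :
  (forall e, 0 < e -> exists n0, forall n k,
     (n0 <= n)%N -> (n0 <= k)%N -> (u n - u k) ^+ 2 <= e) ->
  exists l : R, u @ \oo --> l.
Proof.
move=> uC; apply/cvg_ex/cauchy_cvgP/cauchy_exP => e e0.
have [n0 un0] := uC (e ^+ 2 / 4) ltac:(by rewrite divr_gt0// exprn_gt0).
exists (u n0); exists n0 => // n /= n0n; rewrite -ball_normE /ball_/=.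
rewrite -(@ltr_pXn2r _ 2)// ?nnegrE ?normr_ge0 ?(ltW e0)// real_normK ?num_real//.
apply: le_lt_trans (un0 n0 n (leqnn _) n0n) _.
by have := exprn_gt0 2 e0; lra.
Qed.

Lemma complex_cauchy_cvg (c : nat -> R[i]) :
  (forall e, 0 < e -> exists n0, forall n k,
     (n0 <= n)%N -> (n0 <= k)%N -> sqmod (c n - c k) <= e) ->
  exists l : R[i], sqmod (c n - l) @[n --> \oo] --> (0 : R).
Proof.
move=> cC.
have [a ca] : exists a, (complex.Re (c n)) @[n --> \oo] --> (a : R).
  apply: real_cauchy_cvg => e /cC[n0 cn0]; exists n0 => n k n0n n0k.
  apply: le_trans (cn0 n k n0n n0k); rewrite sqmodE.
  by case: (c n) (c k) => [? ?] [? ?]/=; rewrite lerDl sqr_ge0.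
have [b cb] : exists b, (complex.Im (c n)) @[n --> \oo] --> (b : R).
  apply: real_cauchy_cvg => e /cC[n0 cn0]; exists n0 => n k n0n n0k.
  apply: le_trans (cn0 n k n0n n0k); rewrite sqmodE.
  by case: (c n) (c k) => [? ?] [? ?]/=; rewrite lerDr sqr_ge0.
exists (a +i* b)%C.
have -> : (fun n => sqmod (c n - (a +i* b)%C)) =
    (fun n => (complex.Re (c n) - a) * (complex.Re (c n) - a)
      + (complex.Im (c n) - b) * (complex.Im (c n) - b)).
  by apply/funext => n; rewrite sqmodE; case: (c n) => p q /=; rewrite !expr2.
have a0 : complex.Re (c n) - a @[n --> \oo] --> (0 : R).
  by rewrite -(subrr a); apply: cvgB => //; exact: cvg_cst.
have b0 : complex.Im (c n) - b @[n --> \oo] --> (0 : R).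
  by rewrite -(subrr b); apply: cvgB => //; exact: cvg_cst.
have -> : (0 : R) = 0 * 0 + 0 * 0 by rewrite mul0r addr0.
by apply: cvgD; apply: cvgM.
Qed.

End SquaredModulus.

(** * The weighted space l2(V, m): norm bounds, completeness, convergence, dimension *)

Section Ell2Theory.
Variables (R : realType) (V : countType) (m : V -> R).
Hypothesis m_gt0 : forall x, 0 < m x.
Local Notation F := (V -> R[i]).
Local Notation N f := (l2_sqnorm m f%R).
Implicit Types (f g h v : F) (a b e : R) (u : nat -> F).

Lemma l2_sqnorm_ge_sum f (s : seq V) : uniq s ->
  ((\sum_(x <- s) m x * sqmod (f x))%:E <= N f)%E.
Proof.
move=> us; apply: esum_ge; exists [set` s]; first by split => //; exact: finite_seq.
by rewrite -fsbig_seq// sumEFin.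
Qed.

(** The squared norm is a supremum of finite sums. Bounding it by a real through these sums keeps
    the later estimates within real arithmetic. *)
Lemma l2_sqnorm_leP f a :
  (N f <= a%:E)%E <->
  forall s : seq V, uniq s -> \sum_(x <- s) m x * sqmod (f x) <= a.
Proof.
split=> [Na s us|H].
  by rewrite -lee_fin; apply: le_trans Na; exact: l2_sqnorm_ge_sum.
apply: ge_ereal_sup => _ [A [Af _] <-].
by rewrite fsbig_finite// sumEFin lee_fin; apply: H; exact: fset_uniq.
Qed.

Lemma l2_sqnorm_pointwise f a x : (N f <= a%:E)%E -> m x * sqmod (f x) <= a.
Proof. by move/l2_sqnorm_leP => /(_ [:: x] erefl); rewrite big_seq1. Qed.

Lemma l2_sqnorm_ge0 f : (0 <= N f)%E.
Proof.
apply: esum_ge0 => x _.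
by rewrite lee_fin mulr_ge0// ?sqr_ge0// ltW.
Qed.

Lemma l2P f : l2 m f <-> exists a, (N f <= a%:E)%E.
Proof.
split; last by case=> a /le_lt_trans; apply; rewrite ltry.
rewrite /l2/=; have := l2_sqnorm_ge0 f.
by case: (N f) => // r _ _; exists r.
Qed.

Lemma l2_sqnormD f g a b :
  (N f <= a%:E)%E -> (N g <= b%:E)%E -> (N (f + g) <= (2 * a + 2 * b)%:E)%E.
Proof.
move=> /l2_sqnorm_leP fa /l2_sqnorm_leP gb; apply/l2_sqnorm_leP => s us.
have := fa s us; have := gb s us => gs fs.
apply: le_trans (lerD (ler_wpM2l _ fs) (ler_wpM2l _ gs)) => //.
rewrite !mulr_sumr -big_split/=; apply: ler_sum => x _.
have -> : 2 * (m x * sqmod (f x)) + 2 * (m x * sqmod (g x)) =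
  m x * (2 * sqmod (f x) + 2 * sqmod (g x)) by ring.
by apply: ler_wpM2l (sqmodD_le _ _); rewrite ltW.
Qed.

Lemma l2_sqnormZ (c : R[i]) f a :
  (N f <= a%:E)%E -> (N (c *: f) <= (sqmod c * a)%:E)%E.
Proof.
move=> /l2_sqnorm_leP fa; apply/l2_sqnorm_leP => s us.
apply: le_trans (ler_wpM2l (sqmod_ge0 c) (fa s us)).
rewrite mulr_sumr; apply: ler_sum => x _.
by rewrite -[(c *: f) x]/(c * f x) sqmodM mulrCA.
Qed.

Lemma l2_sqnormN f : N (- f) = N f.
Proof. by apply: eq_esum => x _; rewrite -[in LHS]/(sqmod (- f x)) sqmodN. Qed.

Lemma l2_sqnorm0 : N 0 = 0%E.
Proof. by apply: esum1 => x _; rewrite Normc.normc0 expr0n mulr0. Qed.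

Lemma l2_sqnormB f g a b :
  (N f <= a%:E)%E -> (N g <= b%:E)%E -> (N (f - g) <= (2 * a + 2 * b)%:E)%E.
Proof. by move=> fa gb; apply: l2_sqnormD => //; rewrite l2_sqnormN. Qed.

Lemma l2D f g : l2 m f -> l2 m g -> l2 m (f + g).
Proof.
by move=> /l2P[a fa] /l2P[b gb]; apply/l2P; eexists; exact: l2_sqnormD fa gb.
Qed.

Lemma l2Z c f : l2 m f -> l2 m (c *: f).
Proof. by move=> /l2P[a fa]; apply/l2P; eexists; exact: l2_sqnormZ fa. Qed.

Lemma l2B f g : l2 m f -> l2 m g -> l2 m (f - g).
Proof. by move=> lf lg; apply: l2D => //; rewrite /l2/= l2_sqnormN. Qed.

Lemma l2_sqnorm_fset (A : {fset V}) f :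
  (forall x, x \notin A -> f x = 0) ->
  N f = (\sum_(x <- A) m x * sqmod (f x))%:E.
Proof.
move=> fA; have ge0 x : (0 <= (m x * Normc.normc (f x) ^+ 2)%:E)%E.
  by rewrite lee_fin mulr_ge0// ?sqr_ge0// ltW.
transitivity (\esum_(x in [set` A]) (m x * Normc.normc (f x) ^+ 2)%:E).
  rewrite [RHS]esum_mkcond; apply: eq_esum => x _.
  case: ifPn => //; rewrite notin_setE/= => /negP/fA ->.
  by rewrite Normc.normc0 expr0n mulr0.
by rewrite esum_fset// -fsbig_seq// sumEFin.
Qed.

Lemma finitely_supported_l2 f : finitely_supported f -> l2 m f.
Proof.
move=> ff; rewrite /l2/= (@l2_sqnorm_fset (fset_set [set x | f x != 0])) ?ltry//.
by move=> x; rewrite in_fset_set// notin_setE/= => /negP; rewrite negbK => /eqP.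
Qed.

Lemma l2_cvgP u f :
  l2_cvg m u f <-> forall e, 0 < e ->
    exists n0, forall n, (n0 <= n)%N -> (N (u n - f) <= e%:E)%E.
Proof.
split=> [uf e e0|H].
  move/fine_cvgP: uf => [[n1 _ n1P] /cvgrPdist_le /(_ _ e0) [n2 _ n2P]].
  exists (maxn n1 n2) => n; rewrite geq_max => /andP[/n1P/= nf /n2P/=].
  rewrite sub0r normrN => le_e; rewrite -(fineK nf) lee_fin.
  by apply: le_trans le_e; rewrite ler_norm.
apply/fine_cvgP; split.
  have [n0 n0P] := H 1 ltr01; exists n0 => // n /n0P/= le1.
  by rewrite ge0_fin_numE ?l2_sqnorm_ge0// (le_lt_trans le1)// ltry.
apply/cvgrPdist_le => e e0; have [n0 n0P] := H e e0; exists n0 => // n /n0P/=.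
move=> le_e; rewrite sub0r normrN ger0_norm ?fine_ge0 ?l2_sqnorm_ge0//.
rewrite -lee_fin fineK// ge0_fin_numE ?l2_sqnorm_ge0//.
by rewrite (le_lt_trans le_e)// ltry.
Qed.

(** The pointwise limit is the limit in norm: the Cauchy bound restricts to every finite set of
    vertices with the same threshold, and passes to the limit there. *)
Lemma l2_complete u :
  (forall e, 0 < e -> exists n0, forall n k,
     (n0 <= n)%N -> (n0 <= k)%N -> (N (u n - u k) <= e%:E)%E) ->
  exists f, l2_cvg m u f.
Proof.
move=> uC.
have lims x : exists l : R[i], sqmod (u n x - l) @[n --> \oo] --> (0 : R).
  apply: complex_cauchy_cvg => e e0.
  have [n0 n0P] := uC (m x * e) (mulr_gt0 (m_gt0 x) e0).
  exists n0 => n k /n0P/[apply] /(l2_sqnorm_pointwise x).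
  by rewrite ler_pM2l.
have [f uf] := choice lims; exists f; apply/l2_cvgP => e e0.
(* Two errors of [e / 4], each doubled by [sqmodD_le], add up to [e]; the same split recurs
   below. *)
have [n0 n0P] := uC (e / 4) ltac:(by rewrite divr_gt0).
exists n0 => n n0n; apply/l2_sqnorm_leP => s us.
have cs : \sum_(x <- s) m x * sqmod (u k x - f x) @[k --> \oo] --> (0 : R).
  elim: {us}s => [|x s IH].
    by under eq_fun do rewrite big_nil; exact: cvg_cst.
  under eq_fun do rewrite big_cons.
  have cx : m x * sqmod (u k x - f x) @[k --> \oo] --> m x * 0.
    by apply: cvgMl_tmp; exact: uf.
  by have := cvgD cx IH; rewrite mulr0 addr0; exact.
move/cvgrPdist_le : cs => /(_ (e / 4)) []; first by rewrite divr_gt0.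
(* The intermediate index [k] may depend on the finite set [s]; the threshold [n0] does not. *)
move=> n1 _ n1P; pose k := maxn n0 n1.
have /l2_sqnorm_leP/(_ _ us) := n0P n k n0n (leq_maxl _ _).
have := n1P k (leq_maxr _ _); rewrite sub0r normrN ger0_norm; last first.
  by apply: sumr_ge0 => x _; rewrite mulr_ge0 ?sqmod_ge0 ?ltW.
move=> /= kf nk.
apply: (@le_trans _ _ (2 * (e / 4) + 2 * (e / 4))); last by lra.
apply: le_trans (lerD (ler_wpM2l _ nk) (ler_wpM2l _ kf)) => //.
rewrite !mulr_sumr -big_split/=; apply: ler_sum => x _.
have -> : 2 * (m x * sqmod ((u n - u k) x)) + 2 * (m x * sqmod (u k x - f x)) =
  m x * (2 * sqmod (u n x - u k x) + 2 * sqmod (u k x - f x)) by ring.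
apply: ler_wpM2l; first by rewrite ltW.
have -> : (u n - f) x = (u n x - u k x) + (u k x - f x) by rewrite addrA subrK.
exact: sqmodD_le.
Qed.

Lemma l2_sqnormBC f g : N (f - g) = N (g - f).
Proof. by rewrite -l2_sqnormN opprB. Qed.

Lemma l2_sqnorm_triangle h f g a b :
  (N (f - h) <= a%:E)%E -> (N (h - g) <= b%:E)%E ->
  (N (f - g) <= (2 * a + 2 * b)%:E)%E.
Proof.
move=> fh hg; have -> : f - g = (f - h) + (h - g) by rewrite addrA subrK.
exact: l2_sqnormD.
Qed.

Lemma l2_cvgD u w f g :
  l2_cvg m u f -> l2_cvg m w g -> l2_cvg m (fun n => u n + w n) (f + g).
Proof.
move=> /l2_cvgP uf /l2_cvgP wg; apply/l2_cvgP => e e0.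
have e4 : 0 < e / 4 by rewrite divr_gt0.
have [[n1 n1P] [n2 n2P]] := (uf _ e4, wg _ e4).
exists (maxn n1 n2) => n; rewrite geq_max => /andP[/n1P un /n2P wn].
rewrite opprD addrACA; apply: le_trans (l2_sqnormD un wn) _.
by rewrite lee_fin; lra.
Qed.

Lemma l2_cvgZ (c : R[i]) u f :
  l2_cvg m u f -> l2_cvg m (fun n => c *: u n) (c *: f).
Proof.
move=> /l2_cvgP uf; apply/l2_cvgP => e e0.
have c1 : 0 < sqmod c + 1 by rewrite ltr_wpDl ?sqmod_ge0.
have [n0 n0P] := uf _ (divr_gt0 e0 c1); exists n0 => n /n0P un.
rewrite -scalerBr; apply: le_trans (l2_sqnormZ c un) _.
rewrite lee_fin mulrCA; apply: ler_piMr; first exact: ltW.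
by rewrite ler_pdivrMr// mul1r; lra.
Qed.

Lemma l2_cvgB u w f g :
  l2_cvg m u f -> l2_cvg m w g -> l2_cvg m (fun n => u n - w n) (f - g).
Proof.
move=> uf /(l2_cvgZ (-1)) wg; rewrite -scaleN1r.
by under eq_fun do rewrite -scaleN1r; exact: l2_cvgD.
Qed.

Lemma l2_cvg_cst f : l2_cvg m (fun=> f) f.
Proof.
apply/l2_cvgP => e e0; exists 0%N => n _.
by rewrite subrr l2_sqnorm0 lee_fin ltW.
Qed.

Lemma l2_cvg_l2 u f : (forall n, l2 m (u n)) -> l2_cvg m u f -> l2 m f.
Proof.
move=> lu /l2_cvgP/(_ _ ltr01)[n0 /(_ n0 (leqnn _)) un0].
have -> : f = u n0 - (u n0 - f) by rewrite subKr.
by apply: l2B => //; apply/l2P; exists 1.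
Qed.

Lemma l2_cvg_at u f x e : l2_cvg m u f -> 0 < e ->
  exists n0, forall n, (n0 <= n)%N -> sqmod (u n x - f x) <= e.
Proof.
move=> /l2_cvgP uf e0; have [n0 n0P] := uf _ (mulr_gt0 (m_gt0 x) e0).
by exists n0 => n /n0P/(l2_sqnorm_pointwise x); rewrite ler_pM2l.
Qed.

Lemma l2_cvg_unique u f g : l2_cvg m u f -> l2_cvg m u g -> f = g.
Proof.
move=> uf ug; apply/funext => x; apply/eqP; rewrite -subr_eq0 -sqmod_eq0.
rewrite eq_le sqmod_ge0 andbT; apply/ler_addgt0Pl => e e0; rewrite addr0.
have e4 : 0 < e / 4 by rewrite divr_gt0.
have [[n1 n1P] [n2 n2P]] := (l2_cvg_at x uf e4, l2_cvg_at x ug e4).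
pose n := maxn n1 n2.
have := n1P n (leq_maxl _ _); have := n2P n (leq_maxr _ _) => gn fn.
have -> : f x - g x = - (u n x - f x) + (u n x - g x) by ring.
by apply: le_trans (sqmodD_le _ _) _; rewrite sqmodN; lra.
Qed.

(** Serves to discard the part of an approximating sequence carried by a finite set on which the
    limit vanishes. *)
Lemma l2_cvg_sum0 (I : eqType) (r : seq I) (c : nat -> I -> R[i]) (w : I -> F) :
  (forall i, l2 m (w i)) ->
  (forall i e, i \in r -> 0 < e ->
    exists n0, forall n, (n0 <= n)%N -> sqmod (c n i) <= e) ->
  l2_cvg m (fun n => \sum_(i <- r) c n i *: w i) 0.
Proof.
move=> lw; elim: r => [|i r IH] c0.
  by under eq_fun do rewrite big_nil; exact: l2_cvg_cst.
have -> : (fun n => \sum_(j <- i :: r) c n j *: w j) =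
    (fun n => c n i *: w i + \sum_(j <- r) c n j *: w j).
  by apply/funext => n; rewrite big_cons.
rewrite -[X in l2_cvg _ _ X]addr0; apply: l2_cvgD; last first.
  by apply: IH => j e jr; apply: c0; rewrite inE jr orbT.
apply/l2_cvgP => e e0; have /l2P[a wa] := lw i.
(* Adding 1 keeps the divisor positive when [w i] has norm zero. *)
have a1 : 0 < `|a| + 1 by rewrite ltr_wpDl.
have [n0 n0P] := c0 i _ (mem_head _ _) (divr_gt0 e0 a1).
exists n0 => n /n0P cn; rewrite subr0.
apply: le_trans (l2_sqnormZ _ wa) _; rewrite lee_fin.
apply: le_trans (ler_wpM2l (sqmod_ge0 _) (ler_norm a)) _.
apply: le_trans (ler_wpM2r (normr_ge0 a) cn) _.
by rewrite mulrAC ler_pdivrMr// ler_pM2l//; lra.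
Qed.

(** Evaluate one more vector than [K] has points at the points of [K]. The resulting matrix has a
    nonzero left kernel vector, that is, a combination vanishing on [K]; by injectivity it is zero,
    against independence. *)
Lemma infinite_dimN (P : set F) (K : {fset V}) :
  P 0 -> (forall f g, P f -> P g -> P (f + g)) ->
  (forall (c : R[i]) f, P f -> P (c *: f)) ->
  (forall f, P f -> (forall x, x \in K -> f x = 0) -> f = 0) ->
  ~ infinite_dim P.
Proof.
move=> P0 PD PZ inj /(_ #|{: K}|.+1)[e Pe indep].
pose M : 'M[R[i]]_(#|{: K}|.+1, #|{: K}|) := \matrix_(i, j) e i (val (enum_val j)).
have : kermx M != 0.
  by rewrite -mxrank_eq0 mxrank_ker subn_eq0 -ltnNge ltnS rank_leq_col.
move=> /rowV0Pn[v /sub_kermxP vM /negP]; apply; apply/eqP/rowP => i.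
rewrite mxE; apply: (indep (fun i => v 0 i)); apply: inj.
  by elim/big_rec: _ => // j f _ Pf; apply: PD => //; exact: PZ.
move=> x xK; have /rowP/(_ (enum_rank [` xK]%fset)) := vM.
rewrite !mxE => <-; rewrite fct_sumE; apply: eq_bigr => j _.
by rewrite !mxE enum_rankK.
Qed.

(** * Closed subspaces and their sums with finitely many lines *)

Definition l2_subspace (S : set F) :=
  [/\ S 0, (forall f g, S f -> S g -> S (f + g)),
      (forall (c : R[i]) f, S f -> S (c *: f)) & S `<=` l2 m].

Lemma l2_subspaceB S f g : l2_subspace S -> S f -> S g -> S (f - g).
Proof. by case=> _ SD SZ _ Sf Sg; apply: SD => //; rewrite -scaleN1r; exact: SZ. Qed.

Definition l2_closure (S : set F) : set F :=
  [set g | l2 m g /\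
    forall e, 0 < e -> exists2 h, S h & (N (h - g) <= e%:E)%E].

Lemma sub_l2_closure S : S `<=` l2 m -> S `<=` l2_closure S.
Proof.
move=> Sl f Sf; split; first exact: Sl.
by move=> e e0; exists f => //; rewrite subrr l2_sqnorm0 lee_fin ltW.
Qed.

Lemma l2_closedP S : l2_closed m S <-> l2_closure S `<=` S.
Proof.
split=> [cS g [lg gS]|cS g lg gS]; last first.
  by apply: cS; split => // e /gS[h Sh /ltW]; exists h.
(* Halving [e] passes from the large inequality of [l2_closure] to the strict one of [l2_closed]. *)
apply: cS => // e e0; have [|h Sh le2] := gS (e / 2); first by rewrite divr_gt0.
exists h => //; apply: le_lt_trans le2 _; rewrite lte_fin; lra.
Qed.

Lemma l2_closure_closed S : l2_closed m (l2_closure S).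
Proof.
apply/l2_closedP => g [lg gS]; split => // e e0.
have e4 : 0 < e / 4 by rewrite divr_gt0.
have [h [lh /(_ _ e4)[k Sk kh]] hg] := gS _ e4.
exists k => //; apply: le_trans (l2_sqnorm_triangle kh hg) _.
by rewrite lee_fin; lra.
Qed.

Lemma l2_closure_subspace S : l2_subspace S -> l2_subspace (l2_closure S).
Proof.
move=> SS; have [S0 SD SZ Sl] := SS; split; last by move=> f [].
- exact: sub_l2_closure.
- move=> f g [lf fS] [lg gS]; split; first exact: l2D.
  move=> e e0; have e4 : 0 < e / 4 by rewrite divr_gt0.
  have [h Sh hf] := fS _ e4; have [k Sk kg] := gS _ e4.
  exists (h + k); first exact: SD.
  rewrite opprD addrACA; apply: le_trans (l2_sqnormD hf kg) _.
  by rewrite lee_fin; lra.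
- move=> c f [lf fS]; split; first exact: l2Z.
  move=> e e0; have c1 : 0 < sqmod c + 1 by rewrite ltr_wpDl ?sqmod_ge0.
  have [h Sh hf] := fS _ (divr_gt0 e0 c1).
  exists (c *: h); first exact: SZ.
  rewrite -scalerBr; apply: le_trans (l2_sqnormZ c hf) _.
  rewrite lee_fin mulrCA; apply: ler_piMr; first exact: ltW.
  by rewrite ler_pdivrMr// mul1r; lra.
Qed.

Definition add_line (S : set F) v : set F :=
  [set f | exists s (c : R[i]), S s /\ f = s + c *: v].

Lemma sub_add_line S v : S `<=` add_line S v.
Proof. by move=> f Sf; exists f, 0; rewrite scale0r addr0. Qed.

Lemma add_line_subspace S v :
  l2_subspace S -> l2 m v -> l2_subspace (add_line S v).
Proof.
move=> [S0 SD SZ Sl] lv; split.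
- exact: sub_add_line.
- move=> _ _ [s [c [Ss ->]]] [t [d [St ->]]].
  by exists (s + t), (c + d); rewrite scalerDl addrACA; split => //; exact: SD.
- move=> a _ [s [c [Ss ->]]].
  by exists (a *: s), (a * c); rewrite scalerDr scalerA; split => //; exact: SZ.
- by move=> _ [s [c [Ss ->]]]; apply: l2D; [exact: Sl|exact: l2Z].
Qed.

(* A vector v off the closed subspace S is at positive distance from it, so the
   v-coordinate is bounded by the norm and the coordinates of an approximating
   sequence converge. *)
Lemma add_line_closed S v :
  l2_subspace S -> l2 m v -> l2_closed m S -> l2_closed m (add_line S v).
Proof.
move=> SS lv cS; have [S0 SD SZ Sl] := SS.
have [Sv|nSv] := pselect (S v).
  rewrite (_ : add_line S v = S)//; apply/seteqP; split; last exact: sub_add_line.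
  by move=> _ [s [c [Ss ->]]]; apply: SD => //; exact: SZ.
have [e0 e0_gt0 far] : exists2 e0, 0 < e0 &
    forall h, S h -> ~ (N (h - v) <= e0%:E)%E.
  apply: contra_notP nSv => H; apply/(l2_closedP S).1 => //; split=> // e e_gt0.
  apply: contra_notP H => nS; exists e => // h Sh hv; apply: nS; by exists h.
(* For nonzero [c], the vector - s / c of [S] is at squared distance at most a / |c|^2 from [v],
   which must exceed [e0]. *)
have coord s c a : S s -> (N (s + c *: v) <= a%:E)%E -> sqmod c * e0 <= a.
  move=> Ss sa; have [->|c0] := eqVneq c 0.
    rewrite sqmod0 mul0r -lee_fin; apply: le_trans sa; exact: l2_sqnorm_ge0.
  have c0' := sqmod_gt0 c0.
  rewrite leNgt; apply/negP => alt; apply: (far (- c^-1 *: s)).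
    exact: SZ.
  have -> : - c^-1 *: s - v = - c^-1 *: (s + c *: v).
    by rewrite scalerDr scalerA mulNr mulVf// scaleN1r.
  apply: le_trans (l2_sqnormZ _ sa) _.
  by rewrite lee_fin sqmodN sqmodV mulrC ler_pdivrMr// ltW// mulrC.
apply/l2_closedP => g [lg gS].
have /choice[h hP] : forall n, exists h : F * R[i],
    S h.1 /\ (N (h.1 + h.2 *: v - g) <= (n.+1%:R^-1)%:E)%E.
  move=> n; have [|_ [s [c [Ss ->]]] le_n] := gS (n.+1%:R^-1).
    by rewrite invr_gt0.
  by exists (s, c).
have [c hc] : exists c, sqmod ((h n).2 - c) @[n --> \oo] --> (0 : R).
  apply: complex_cauchy_cvg => e e_gt0.
  (* By [coord], the squared difference of two coordinates times [e0] is at most 2/(n+1) + 2/(k+1),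
     hence the threshold e e0 / 4. *)
  have [n0 n0P] := harmonic_le (divr_gt0 (mulr_gt0 e_gt0 e0_gt0) (ltr0n R 4)).
  exists n0 => n k /n0P n_le /n0P k_le.
  have [[Sn hn] [Sk hk]] := (hP n, hP k).
  rewrite -(ler_pM2r e0_gt0).
  apply: le_trans (coord ((h n).1 - (h k).1) _
    (2 * n.+1%:R^-1 + 2 * k.+1%:R^-1) _ _) _.
  - exact: l2_subspaceB.
  - rewrite l2_sqnormBC in hk.
    have := l2_sqnorm_triangle hn hk; congr (N _ <= _)%E.
    by rewrite scalerBl opprD addrACA.
  - by move: n_le k_le; move: (n.+1%:R^-1) (k.+1%:R^-1) => p q; lra.
(* Since the coordinates converge to [c], the components [(h n).1] in [S] approximate g - c v, which
   then lies in [S] by closedness. *)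
exists (g - c *: v), c; rewrite subrK; split => //.
apply/(l2_closedP S).1 => //; split; first by apply: l2B => //; exact: l2Z.
move=> e e_gt0; have /l2P[a va] := lv.
have a1 : 0 < `|a| + 1 by rewrite ltr_wpDl.
have e4 : 0 < e / 4 by rewrite divr_gt0.
have /cvgrPdist_le/(_ _ (divr_gt0 e4 a1))[n0 _ n0P] := hc.
have [n1 n1P] := harmonic_le e4.
pose n := maxn n0 n1; have n_le := n1P n (leq_maxr _ _).
have := n0P n (leq_maxl _ _).
rewrite /= sub0r normrN (ger0_norm (sqmod_ge0 _)) => c_le.
have [Sn hn] := hP n; exists (h n).1 => //.
have -> : (h n).1 - (g - c *: v) =
    ((h n).1 + (h n).2 *: v - g) - ((h n).2 - c) *: v.
  apply/funext => x; change ((h n).1 x - (g x - c * v x) =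
    (h n).1 x + (h n).2 * v x - g x - ((h n).2 - c) * v x).
  ring.
apply: le_trans (l2_sqnormB hn (l2_sqnormZ _ va)) _; rewrite lee_fin.
have : sqmod ((h n).2 - c) * a <= e / 4.
  apply: le_trans (ler_wpM2l (sqmod_ge0 _) (ler_norm a)) _.
  apply: le_trans (ler_wpM2r (normr_ge0 a) c_le) _.
  by rewrite mulrAC ler_pdivrMr// ler_pM2l//; lra.
by move: n_le; move: (n.+1%:R^-1) (sqmod _ * a) => p q; lra.
Qed.

(** Adding one line at a time lets closedness follow from [add_line_closed] by induction on [r]. *)
Definition add_span (I : Type) (S : set F) (w : I -> F) (r : seq I) : set F :=
  foldr (fun i T => add_line T (w i)) S r.

Lemma add_span_closed_subspace (I : Type) S (w : I -> F) r :
  l2_subspace S -> l2_closed m S -> (forall i, l2 m (w i)) ->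
  l2_subspace (add_span S w r) /\ l2_closed m (add_span S w r).
Proof.
move=> SS cS lw; elim: r => [//|i r [SS' cS']].
by split; [exact: add_line_subspace|exact: add_line_closed].
Qed.

Lemma add_span_sum (I : Type) S (w : I -> F) (r : seq I) (c : I -> R[i]) s :
  S s -> add_span S w r (s + \sum_(i <- r) c i *: w i).
Proof.
move=> Ss; elim: r => [|i r IH]; first by rewrite big_nil addr0.
exists (s + \sum_(i <- r) c i *: w i), (c i); split => //.
by rewrite big_cons addrCA addrC.
Qed.

Lemma add_span_sub (I : Type) S (w : I -> F) (r : seq I) (T : set F) :
  (forall f g, T f -> T g -> T (f + g)) ->
  (forall (c : R[i]) f, T f -> T (c *: f)) ->
  S `<=` T -> (forall i, T (w i)) -> add_span S w r `<=` T.
Proof.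
move=> TD TZ ST wT; elim: r => [//|i r IH] _ [s [c [Ss ->]]].
by apply: TD; [exact: IH|exact: TZ].
Qed.

End Ell2Theory.

(* Induction on the size of the support U of phi: subtracting min_U phi times
   the indicator of U keeps phi nonnegative, shrinks the support, and splits
   both sides additively. *)
Lemma coarea_inequality (R : realType) (V : choiceType) (b : V -> V -> R)
    (beta : V -> R) (h : R) (A : {fset V}) (s : seq V) (phi : V -> R) :
  (forall U : {fset V}, U != fset0 -> (U `<=` A)%fset ->
    h * \sum_(x <- s) beta x * (x \in U)%:R <=
    \sum_(x <- s) \sum_(y <- s) b x y * `|(x \in U)%:R - (y \in U)%:R|) ->
  (forall x, 0 <= phi x) -> (forall x, x \notin A -> phi x = 0) ->
  h * \sum_(x <- s) beta x * phi x <=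
  \sum_(x <- s) \sum_(y <- s) b x y * `|phi x - phi y|.
Proof.
move=> isop.
have [n] := ubnP #|` [fset x in A | phi x != 0]%fset|; elim: n phi => // n IH phi.
set U := [fset x in A | phi x != 0]%fset => Un phi0 phiA.
have inU x : (x \in U) = (phi x != 0).
  by rewrite !inE; case: (boolP (x \in A)) => //= /phiA ->; rewrite eqxx.
have [U0|U0] := eqVneq U fset0.
  have phi00 x : phi x = 0.
    by apply/eqP; rewrite -[_ == _]negbK -inU U0 inE.
  rewrite !big1 ?mulr0// => x _; last by rewrite phi00 mulr0.
  by rewrite big1// => y _; rewrite !phi00 subrr normr0 mulr0.
have [x0 x0U] := fset0Pn _ U0.
have [x1 x1U x1min] : exists2 x1, x1 \in U & forall x, x \in U -> phi x1 <= phi x.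
  have [i _ imin] := @arg_minP _ _ U [` x0U]%fset predT (fun i => phi (val i)) isT.
  exists (val i); first exact: valP.
  by move=> x xU; exact: (imin [` xU]%fset).
pose psi x := phi x - phi x1 * (x \in U)%:R.
have psi_ge0 x : 0 <= psi x.
  rewrite /psi; case: (boolP (x \in U)) => [/x1min|_].
    by rewrite mulr1 subr_ge0.
  by rewrite mulr0 subr0.
have psi0 x : phi x = 0 -> psi x = 0.
  by move=> p0; rewrite /psi inU p0 eqxx mulr0 subr0.
have IHpsi : h * \sum_(x <- s) beta x * psi x <=
    \sum_(x <- s) \sum_(y <- s) b x y * `|psi x - psi y|.
  apply: IH => //; last by move=> x /phiA; exact: psi0.
  rewrite -ltnS; apply: leq_trans Un; rewrite ltnS; apply: fproper_ltn_card.
  rewrite fproperE; apply/andP; split.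
    apply/fsubsetP => x; rewrite inE => /andP[xA] psix; rewrite inU.
    by apply: contraNN psix => /eqP/psi0/eqP.
  by apply/fsubsetPn; exists x1 => //; rewrite !inE /psi x1U mulr1 subrr eqxx andbF.
have UA : (U `<=` A)%fset by apply/fsubsetP => x; rewrite inE => /andP[].
(* The induction hypothesis for [psi] is added to the isoperimetric inequality for [U] scaled by the
   minimum [phi x1]; what remains is to recombine both sides termwise. *)
have := lerD IHpsi (ler_wpM2l (phi0 x1) (isop U U0 UA)).
rewrite mulrCA -mulrDr [phi x1 * _]mulr_sumr -big_split/=.
rewrite [phi x1 * _]mulr_sumr -big_split/=; congr (_ * _ <= _).
  by apply: eq_bigr => x _; rewrite /psi; ring.
apply: eq_bigr => x _; rewrite mulr_sumr -big_split/=; apply: eq_bigr => y _.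
rewrite mulrCA -mulrDr; congr (_ * _); rewrite /psi.
have := phi0 x1.
(* For both ends in [U], or both outside, the indicators cancel. Across the boundary [phi] vanishes
   at the outer end, and minimality of [phi x1] makes the two absolute values add up without
   loss. *)
case: (boolP (x \in U)) => xU; case: (boolP (y \in U)) => yU p1.
- by rewrite subrr normr0 !mulr0 addr0 !mulr1; congr (`|_|); ring.
- have -> : phi y = 0 by apply/eqP; rewrite -[_ == _]negbK -inU.
  have := x1min _ xU; rewrite mulr1 mulr0 !subr0 normr1 mulr1 => x1x.
  by rewrite !ger0_norm ?subr_ge0// ?subrK.
- have -> : phi x = 0 by apply/eqP; rewrite -[_ == _]negbK -inU.
  have := x1min _ yU; rewrite mulr1 mulr0 subr0 !sub0r !normrN normr1 mulr1 => x1x.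
  by rewrite !ger0_norm ?subr_ge0// ?subrK.
- by rewrite subrr normr0 !mulr0 addr0 !subr0.
Qed.

(** * Green's formula and Cheeger's inequality for finitely supported functions *)

Section Energy.
Variables (R : realType) (V : countType) (G : wdigraph R V) (m : V -> R).
Hypothesis m_gt0 : forall x, 0 < m x.
Hypothesis lf : locally_finite G.
Local Notation b := (weight G).
Local Notation F := (V -> R[i]).

(** A finite window containing [A] and both ends of every edge that meets [A], so that sums over all
    vertices become sums over [S]. *)
Definition neighborhood (A S : {fset V}) :=
  (A `<=` S)%fset /\
  forall x y, x \in A -> y \notin S -> b x y = 0 /\ b y x = 0.

Lemma weight_eq0 x y : ~ 0 < b x y -> b x y = 0.
Proof.
move=> nb; apply/le_anti/andP; split; last exact: weight_ge0.
by rewrite leNgt; apply/negP.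
Qed.

Lemma neighborhood_ex (A : {fset V}) : exists S, neighborhood A S.
Proof.
pose B := \bigcup_(x in [set` A]) [set y | 0 < b x y \/ 0 < b y x].
have fB : finite_set B by apply: bigcup_finite => // x _; exact: lf.
exists (A `|` fset_set B)%fset; split; first exact: fsubsetUl.
move=> x y xA; rewrite inE in_fset_set// => /norP[_]; rewrite notin_setE => nB.
by split; apply: weight_eq0 => bp; apply: nB; exists x => //=; [left|right].
Qed.

Variables A S : {fset V}.
Hypothesis AS : neighborhood A S.

Lemma beta_out_sum x : x \in A -> beta_out G x = \sum_(y <- S) b x y.
Proof. by move=> xA; apply: fsbigTE => y /(AS.2 x y xA)[]. Qed.

Lemma beta_in_sum x : x \in A -> beta_in G x = \sum_(y <- S) b y x.
Proof. by move=> xA; apply: fsbigTE => y /(AS.2 x y xA)[]. Qed.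

Lemma laplacian_sum (f : F) x : x \in A ->
  laplacian G m f x = ((m x)^-1)%:C%C * \sum_(y <- S) (b x y)%:C%C * (f x - f y).
Proof.
move=> xA; congr (_ * _); apply: fsbigTE => y /(AS.2 x y xA)[-> _].
by rewrite mul0r.
Qed.

Lemma beta_out_set_sum (U : {fset V}) : (U `<=` A)%fset ->
  beta_out_set G [set` U] = \sum_(x <- S) beta_out G x * (x \in U)%:R.
Proof.
move=> UA; rewrite /beta_out_set -fsbig_seq//.
under [RHS]eq_bigr do rewrite mulr_natr mulrb.
rewrite -big_mkcond/= -[RHS]big_filter; apply: perm_big.
apply: uniq_perm; rewrite ?filter_uniq ?fset_uniq// => x; rewrite mem_filter.
apply/idP/idP => [xU|/andP[]//]; rewrite xU/=.
by apply: (fsubsetP AS.1); exact: (fsubsetP UA).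
Qed.

(** The difference of indicators has modulus 1 exactly for pairs crossing the boundary of [U], and
    boundary edges have both ends in [S]. This is the shape required by [coarea_inequality]. *)
Lemma boundary_weight_sum (U : {fset V}) : (U `<=` A)%fset ->
  boundary_weight G [set` U] =
  \sum_(x <- S) \sum_(y <- S) b x y * `|(x \in U)%:R - (y \in U)%:R|.
Proof.
move=> UA; have inS x : x \in U -> x \in S.
  by move=> xU; apply: (fsubsetP AS.1); exact: (fsubsetP UA).
have nbS x y : x \in U -> 0 < b x y \/ 0 < b y x -> y \in S.
  move=> xU bp; apply: contraPT bp => /(AS.2 x y (fsubsetP UA _ xU)) [-> ->].
  by rewrite ltxx => -[].
pose w (e : V * V) := b e.1 e.2 * `|(e.1 \in U)%:R - (e.2 \in U)%:R| : R.
rewrite -(@big_allpairs _ _ _ _ _ _ _ w).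
rewrite -(@fsbig_fwiden _ _ _ _ _ (edge_boundary G [set` U])).
- apply: eq_fsbigr => -[x y] /set_mem [_ /=]; rewrite /w/=.
  case=> -[]; [move=> -> /negP/negbTE ->|move=> /negP/negbTE -> ->].
    by rewrite subr0 normr1 mulr1.
  by rewrite sub0r normrN normr1 mulr1.
- move=> -[x y] [/edgesP bxy xyU] /=; apply: allpairs_f.
    by case: xyU => /= -[] => [xU _|_ yU]; [exact: inS|apply: (nbS y) => //; right].
  by case: xyU => /= -[] => [xU _|_ yU]; [apply: (nbS x) => //; left|exact: inS].
- by apply: allpairs_uniq; rewrite ?fset_uniq// => -[? ?] [? ?].
- move=> -[x y] [_ nB]; rewrite /= /w/=.
  have [bxy|/weight_eq0->] := pselect (0 < b x y); last by rewrite mul0r.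
  have [xU|xU] := boolP (x \in U); have [yU|yU] := boolP (y \in U);
    rewrite ?subrr ?normr0 ?mulr0//; case: nB; split => /=; try exact/edgesP.
    by left; split=> //; exact/negP.
  by right; split=> //; exact/negP.
Qed.

Variables (f : F) (fA : forall x, x \notin A -> f x = 0).

Lemma sum_weight_out :
  \sum_(x <- S) \sum_(y <- S) b x y * sqmod (f x) =
  \sum_(x <- S) beta_out G x * sqmod (f x).
Proof.
apply: eq_bigr => x _; have [xA|/fA->] := boolP (x \in A).
  by rewrite beta_out_sum// mulr_suml.
by rewrite sqmod0 mulr0 big1// => y _; rewrite mulr0.
Qed.

(** Exchanging the sums produces the incoming weight at [y], which assumption (beta) equates with
    the outgoing one. *)
Lemma sum_weight_in : assumption_beta G ->
  \sum_(x <- S) \sum_(y <- S) b x y * sqmod (f y) =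
  \sum_(x <- S) beta_out G x * sqmod (f x).
Proof.
move=> ab; rewrite exchange_big/=.
apply: eq_bigr => y _; have [yA|/fA->] := boolP (y \in A).
  by rewrite ab beta_in_sum// mulr_suml.
by rewrite sqmod0 mulr0 big1// => x _; rewrite mulr0.
Qed.

(* Green's formula; assumption (beta) cancels the terms |f x|^2 - |f y|^2. *)
Lemma green_formula : assumption_beta G ->
  2 * \sum_(x <- S) m x * complex.Re (laplacian G m f x * ((f x)^*)%C) =
  \sum_(x <- S) \sum_(y <- S) b x y * sqmod (f x - f y).
Proof.
move=> ab; have polar z w : 2 * complex.Re ((z - w) * (z^*)%C) =
    sqmod (z - w) + sqmod z - sqmod w :> R.
  rewrite !sqmodE; case: z => p q; case: w => r t /=; ring.
transitivity (\sum_(x <- S) \sum_(y <- S)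
    (b x y * sqmod (f x - f y) + b x y * sqmod (f x) - b x y * sqmod (f y))).
  rewrite mulr_sumr; apply: eq_bigr => x _.
  (* Off [A] the value [f x] is zero: the left side vanishes, and on the right the two terms in |f
     y|^2 cancel. *)
  have [xA|xA] := boolP (x \in A); last first.
    have -> : laplacian G m f x * ((f x)^*)%C = 0.
      by rewrite (fA xA) conjc0 mulr0.
    rewrite !mulr0 (fA xA).
    rewrite big1// => y _; rewrite sqmod0 sub0r sqmodN; ring.
  rewrite laplacian_sum// -mulrA mulr_suml Re_realM.
  rewrite [m x * _]mulrA divff ?gt_eqF// mul1r Re_sum mulr_sumr; apply: eq_bigr => y _.
  by rewrite -mulrA Re_realM mulrCA polar; ring.
under eq_bigr do rewrite sumrB big_split/=.
by rewrite sumrB big_split/= sum_weight_out sum_weight_in// addrK.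
Qed.

(** With B the weighted mass of |f|^2 and E twice the real energy, coarea and AM-GM give h B <=
    (2/h) E + (h/2) B. Absorbing the last term yields h^2 B / 4 <= E. *)
Lemma cheeger_inequality (h : R) : assumption_beta G -> 0 < h ->
  (forall x, 0 < beta_out G x) -> (h%:E <= cheeger G [set` A])%E ->
  h ^+ 2 / 8 * \sum_(x <- S) beta_out G x * sqmod (f x) <=
  \sum_(x <- S) m x * complex.Re (laplacian G m f x * ((f x)^*)%C).
Proof.
move=> ab h0 beta0 hch.
have coarea : h * \sum_(x <- S) beta_out G x * sqmod (f x) <=
    \sum_(x <- S) \sum_(y <- S) b x y * `|sqmod (f x) - sqmod (f y)|.
  apply: (@coarea_inequality _ _ _ _ _ A) => [U U0 UA| |x /fA->].
  - rewrite -boundary_weight_sum// -beta_out_set_sum// -ler_pdivlMr.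
      rewrite -lee_fin; apply: le_trans hch _; apply: ereal_inf_lbound.
      exists [set` U] => //; split => //; last exact/fsubsetP.
      by have [x xU] := fset0Pn _ U0; exists x.
    rewrite /beta_out_set -fsbig_seq ?fset_uniq//.
    have [x xU] := fset0Pn _ U0; rewrite (big_rem x)//=.
    by rewrite ltr_pwDl// sumr_ge0// => y _; exact: ltW.
  - by move=> x; exact: sqmod_ge0.
  - exact: sqmod0.
set B := \sum_(x <- S) beta_out G x * sqmod (f x) in coarea *.
set Q := (X in _ <= X).
have := green_formula ab; rewrite -/Q; set E := (X in _ = X) => QE.
(* With weight t the estimate reads 2t(h - 2t) B <= E, and t = h/4 maximizes the factor. *)
have t0 : 0 < h / 4 by rewrite divr_gt0.
have : h * B <= (2 * (h / 4))^-1 * E + h / 4 * (B + B).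
  apply: le_trans coarea _.
  have -> : B + B = \sum_(x <- S) \sum_(y <- S) b x y * sqmod (f x) +
      \sum_(x <- S) \sum_(y <- S) b x y * sqmod (f y).
    by rewrite sum_weight_out sum_weight_in.
  rewrite -big_split mulr_sumr mulr_sumr -big_split/=; apply: ler_sum => x _.
  rewrite -big_split mulr_sumr mulr_sumr -big_split/=; apply: ler_sum => y _.
  apply: le_trans (ler_wpM2l (weight_ge0 G x y) (sqmod_sub_le _ _ t0)) _.
  by rewrite le_eqVlt; apply/orP; left; apply/eqP; ring.
rewrite -(ler_pM2l h0).
have -> : h * ((2 * (h / 4))^-1 * E + h / 4 * (B + B)) = 2 * E + h * h * B / 2.
  by field; rewrite gt_eqF.
have -> : h ^+ 2 / 8 * B = h * h * B / 8 by ring.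
by rewrite -QE mulrA; lra.
Qed.

End Energy.

(** Put T = Delta - lambda. Cheeger's inequality and the degree bound give Re (T f, f) >= ||f||^2,
    the imaginary part of lambda dropping out. Then 2 Re (T f, f) <= ||T f||^2 + ||f||^2
    concludes. *)
Lemma laplacian_coercive (R : realType) (V : countType) (G : wdigraph R V)
    (m : V -> R) (Omega : set V) (h M : R) (lambda : R[i]) (f : V -> R[i]) :
  (forall x, 0 < m x) -> locally_finite G -> (forall x, 0 < beta_out G x) ->
  assumption_beta G -> 0 < h -> (h%:E <= cheeger G Omega)%E ->
  (M%:E <= min_degree G m Omega)%E -> complex.Re lambda + 1 <= h ^+ 2 / 8 * M ->
  finitely_supported f -> (forall x, f x != 0 -> Omega x) ->
  (l2_sqnorm m f <= l2_sqnorm m (laplacian G m f - lambda *: f)%R)%E.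
Proof.
move=> m0 lf beta0 ab h0 hch Mdeg lamM ff fO.
pose A := fset_set [set x | f x != 0].
have inA x : (x \in A) = (f x != 0).
  by rewrite in_fset_set//; apply/idP/idP => [/set_mem|/mem_set].
have fA x : x \notin A -> f x = 0 by rewrite inA negbK => /eqP.
have [S AS] := neighborhood_ex lf A.
have hA : (h%:E <= cheeger G [set` A])%E.
  apply: le_trans hch _; apply: ereal_inf_le_tmp; apply: image_subset.
  move=> U [U0 Uf UA]; split => // x /UA /=; rewrite inA; exact: fO.
have := cheeger_inequality m0 AS fA ab h0 beta0 hA.
have fS x : x \notin S -> f x = 0.
  by move=> xS; apply: fA; apply: contra xS; exact: (fsubsetP AS.1).
set T := laplacian G m f - lambda *: f.
have degM x : m x * M * sqmod (f x) <= beta_out G x * sqmod (f x).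
  have [->|fx] := eqVneq (f x) 0; first by rewrite sqmod0 !mulr0.
  apply: ler_wpM2r; first exact: sqmod_ge0.
  rewrite mulrC -ler_pdivlMr// -lee_fin; apply: le_trans Mdeg _.
  by apply: ereal_inf_lbound; exists x => //; exact: fO.
have h8 : 0 <= h ^+ 2 / 8 by rewrite divr_ge0// sqr_ge0.
have ReB (p l z : R[i]) : complex.Re ((p - l * z) * (z^*)%C) =
    complex.Re (p * (z^*)%C) - complex.Re l * sqmod z.
  by rewrite sqmodE; case: p => ? ?; case: l => ? ?; case: z => ? ? /=; ring.
have TRe x : m x * complex.Re (T x * ((f x)^*)%C) =
    m x * complex.Re (laplacian G m f x * ((f x)^*)%C) -
    complex.Re lambda * (m x * sqmod (f x)).
  by rewrite [T x]/(laplacian G m f x - lambda * f x) ReB mulrBr mulrCA.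
move=> chI; rewrite (l2_sqnorm_fset m0 fS).
apply: le_trans (l2_sqnorm_ge_sum m T (fset_uniq S)); rewrite lee_fin.
set N := \sum_(x <- S) _; set P := \sum_(x <- S) _.
have N0 : 0 <= N by apply: sumr_ge0 => x _; rewrite mulr_ge0 ?sqmod_ge0 ?ltW.
have NB : M * N <= \sum_(x <- S) beta_out G x * sqmod (f x).
  by rewrite mulr_sumr; apply: ler_sum => x _; rewrite mulrA [M * _]mulrC.
have NP : 2 * \sum_(x <- S) m x * complex.Re (T x * ((f x)^*)%C) <= P + N.
  rewrite mulr_sumr -big_split/=; apply: ler_sum => x _.
  by rewrite mulrCA -mulrDr ler_pM2l// Re_mulJ_le.
move: NP; under eq_bigr do rewrite TRe.
rewrite sumrB -mulr_sumr -/N; set Q := \sum_(x <- S) _ in chI *.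
have := ler_wpM2r N0 lamM; have := ler_wpM2l h8 NB; rewrite mulrA => H1 H2 H3.
have := le_trans H2 (le_trans H1 chI); rewrite mulrDl mul1r; lra.
Qed.

(** * Linearity of the Laplacian, its closure, and the range and kernel of the shifted operator *)

Section LaplacianClosure.
Variables (R : realType) (V : countType) (G : wdigraph R V) (m : V -> R).
Hypothesis m_gt0 : forall x, 0 < m x.
Hypothesis lf : locally_finite G.
Local Notation F := (V -> R[i]).
Local Notation N f := (l2_sqnorm m f%R).
Local Notation L := (laplacian G m).
Local Notation C := (laplacian_closure G m).
Implicit Types f g h : F.

(** By local finiteness the sum at [x] runs over a finite window that does not depend on the
    function, so additivity holds for arbitrary functions. *)
Lemma laplacianD f g : L (f + g) = L f + L g.
Proof.
apply/funext => x; have [S xS] := neighborhood_ex lf [fset x]%fset.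
have LE k := laplacian_sum m xS k (fset11 x).
rewrite -[RHS]/(L f x + L g x) !LE.
rewrite -mulrDr -big_split/=; congr (_ * _); apply: eq_bigr => y _.
by rewrite -mulrDr; congr (_ * _); rewrite !fctE opprD addrACA.
Qed.

Lemma laplacianZ (c : R[i]) f : L (c *: f) = c *: L f.
Proof.
apply/funext => x; have [S xS] := neighborhood_ex lf [fset x]%fset.
have LE k := laplacian_sum m xS k (fset11 x).
rewrite -[RHS]/(c * L f x) !LE mulrCA; congr (_ * _).
rewrite mulr_sumr; apply: eq_bigr => y _; rewrite mulrCA; congr (_ * _).
by rewrite mulrBr.
Qed.

Lemma laplacian0 : L 0 = 0.
Proof. by have := laplacianZ 0 0; rewrite !scale0r. Qed.

Lemma laplacian_finitely_supported f :
  finitely_supported f -> finitely_supported (L f).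
Proof.
move=> ff; pose A := fset_set [set x | f x != 0].
have fA x : x \notin A -> f x = 0.
  by rewrite in_fset_set// notin_setE/= => /negP; rewrite negbK => /eqP.
have [S AS] := neighborhood_ex lf A.
apply: (@sub_finite_set _ _ [set` S]); last exact: finite_fset.
move=> x /=; apply: contraNT => xS; apply/eqP; rewrite /laplacian fsbig1 ?mulr0//.
move=> y _; rewrite (fA x); last by apply: contra xS; exact: (fsubsetP AS.1).
have [yA|/fA ->] := boolP (y \in A); last by rewrite subr0 mulr0.
by have [_ ->] := AS.2 y x yA xS; rewrite mul0r.
Qed.

Lemma finitely_supported0 : finitely_supported (0 : F).
Proof.
rewrite /finitely_supported (_ : [set x | _] = set0)// -subset0 => x /=.
by rewrite eqxx.
Qed.

Lemma finitely_supportedD f g :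
  finitely_supported f -> finitely_supported g -> finitely_supported (f + g).
Proof.
move=> ff gf.
apply: (@sub_finite_set _ _ ([set x | f x != 0] `|` [set x | g x != 0])).
  move=> x /=; rewrite fctE; have [->|] := eqVneq (f x) 0; last by left.
  by rewrite add0r; right.
by rewrite finite_setU.
Qed.

Lemma finitely_supportedZ (c : R[i]) f :
  finitely_supported f -> finitely_supported (c *: f).
Proof.
move=> ff; apply: sub_finite_set ff => x /=; apply: contraNN => /eqP fx.
by rewrite -[(c *: f) x]/(c * f x) fx mulr0.
Qed.

Lemma laplacian_closureD f g f' g' : C f g -> C f' g' -> C (f + f') (g + g').
Proof.
move=> [lf_ lg [u [us uf ug]]] [lf' lg' [u' [us' uf' ug']]].
split; [exact: l2D|exact: l2D|exists (fun n => u n + u' n); split].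
- by move=> n; exact: finitely_supportedD.
- exact: l2_cvgD.
- have -> : (fun n => L (u n + u' n)) = (fun n => L (u n) + L (u' n)).
    by apply/funext => n; exact: laplacianD.
  exact: l2_cvgD.
Qed.

Lemma laplacian_closureZ (c : R[i]) f g : C f g -> C (c *: f) (c *: g).
Proof.
move=> [lf_ lg [u [us uf ug]]].
split; [exact: l2Z|exact: l2Z|exists (fun n => c *: u n); split].
- by move=> n; exact: finitely_supportedZ.
- exact: l2_cvgZ.
- have -> : (fun n => L (c *: u n)) = (fun n => c *: L (u n)).
    by apply/funext => n; exact: laplacianZ.
  exact: l2_cvgZ.
Qed.

Lemma laplacian_closure_core f : finitely_supported f -> C f (L f).
Proof.
move=> ff; split; [exact: finitely_supported_l2| |exists (fun=> f)].
  by apply: finitely_supported_l2 => //; exact: laplacian_finitely_supported.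
by split => //; exact: l2_cvg_cst.
Qed.

Variable lambda : R[i].
Local Notation T f := (laplacian G m f - lambda *: f).

Lemma shiftedD f g : T (f + g) = T f + T g.
Proof. by rewrite laplacianD scalerDr opprD addrACA. Qed.

Lemma shiftedZ c f : T (c *: f) = c *: T f.
Proof. by rewrite laplacianZ scalerBr !scalerA mulrC. Qed.

Lemma shifted0 : T 0 = 0.
Proof. by rewrite laplacian0 scaler0 subr0. Qed.

Lemma shifted_sum (I : Type) (r : seq I) (c : I -> R[i]) (w : I -> F) :
  T (\sum_(i <- r) c i *: w i) = \sum_(i <- r) c i *: T (w i).
Proof.
elim: r => [|i r IH]; last by rewrite !big_cons shiftedD shiftedZ IH.
by rewrite !big_nil shifted0.
Qed.

Lemma shifted_l2 f : finitely_supported f -> l2 m (T f).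
Proof.
move=> ff; apply: l2B => //; last by apply: l2Z => //; exact: finitely_supported_l2.
by apply: finitely_supported_l2 => //; exact: laplacian_finitely_supported.
Qed.

Lemma shifted_rangeD f g : shifted_range C lambda f ->
  shifted_range C lambda g -> shifted_range C lambda (f + g).
Proof.
move=> [u [h [Cuh ->]]] [u' [h' [Cuh' ->]]]; exists (u + u'), (h + h'); split.
  exact: laplacian_closureD.
by rewrite scalerDr opprD addrACA.
Qed.

Lemma shifted_rangeZ (c : R[i]) f :
  shifted_range C lambda f -> shifted_range C lambda (c *: f).
Proof.
move=> [u [h [Cuh ->]]]; exists (c *: u), (c *: h); split.
  exact: laplacian_closureZ.
by rewrite scalerBr !scalerA mulrC.
Qed.

Lemma shifted_rangeT f : finitely_supported f -> shifted_range C lambda (T f).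
Proof.
by move=> ff; exists f, (L f); split => //; exact: laplacian_closure_core.
Qed.

Lemma shifted_kernelD f g : shifted_kernel C lambda f ->
  shifted_kernel C lambda g -> shifted_kernel C lambda (f + g).
Proof.
move=> [h Cfh h0] [h' Cgh' h'0]; exists (h + h'); first exact: laplacian_closureD.
by rewrite scalerDr opprD addrACA h0 h'0 addr0.
Qed.

Lemma shifted_kernelZ (c : R[i]) f :
  shifted_kernel C lambda f -> shifted_kernel C lambda (c *: f).
Proof.
move=> [h Cfh h0]; exists (c *: h); first exact: laplacian_closureZ.
by rewrite scalerA mulrC -scalerA -scalerBr h0 scaler0.
Qed.

(** * Splitting off a finite vertex set: closed range and finite-dimensional kernel *)

Variable K : {fset V}.

Definition supported_off : set F :=
  [set f | finitely_supported f /\ forall x, x \in K -> f x = 0].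

Definition cutoff f : F := fun x => if x \in K then 0 else f x.

Definition delta (x : V) : F := fun y => (y == x)%:R.

Lemma delta_finitely_supported x : finitely_supported (delta x).
Proof.
apply: (@sub_finite_set _ _ [set x]); last exact: finite_set1.
by move=> y /=; rewrite /delta; case: (eqVneq y x) => // _; rewrite eqxx.
Qed.

Lemma cutoff_off f : finitely_supported f -> supported_off (cutoff f).
Proof.
move=> ff; split; last by move=> x; rewrite /cutoff => ->.
apply: sub_finite_set ff => x /=; rewrite /cutoff; case: ifP => //.
by rewrite eqxx.
Qed.

Lemma cutoff_decomp f : f = cutoff f + \sum_(x <- K) f x *: delta x.
Proof.
apply/funext => y; rewrite -[RHS]/(cutoff f y + _) fct_sumE /cutoff.
have E x : (f x *: delta x) y = if x == y then f x else 0.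
  rewrite -[LHS]/(f x * (y == x)%:R) eq_sym.
  by case: eqP => _; rewrite ?mulr1 ?mulr0.
under eq_bigr do rewrite E.
case: ifPn => yK.
  rewrite (big_fsetD1 y)//= eqxx add0r big_seq big1 ?addr0//.
  by move=> x; rewrite !inE => /andP[/negbTE->].
rewrite big_seq big1 ?addr0// => x xK; case: eqP => // xy.
by move: yK; rewrite -xy xK.
Qed.

Lemma shifted_cutoff f :
  T f = T (cutoff f) + \sum_(x <- K) f x *: T (delta x).
Proof. by rewrite {1 2}(cutoff_decomp f) shiftedD shifted_sum. Qed.

(** Supplied in the end by [laplacian_coercive], with [K] a far enough member of the filtration. *)
Hypothesis coercive : forall f, supported_off f -> (N f <= N (T f))%E.

Lemma shifted_off_subspace : l2_subspace m [set T f | f in supported_off].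
Proof.
split.
- by exists 0; [split => //; exact: finitely_supported0|exact: shifted0].
- move=> _ _ [f [ff f0] <-] [g [gf g0] <-]; exists (f + g); last by rewrite shiftedD.
  split; first exact: finitely_supportedD.
  by move=> x xK; rewrite fctE f0// g0// addr0.
- move=> c _ [f [ff f0] <-]; exists (c *: f); last by rewrite shiftedZ.
  split; first exact: finitely_supportedZ.
  by move=> x xK; rewrite -[LHS]/(c * f x) f0// mulr0.
- by move=> _ [f [ff f0] <-]; exact: shifted_l2.
Qed.

(* Coercivity makes preimages of a convergent sequence Cauchy. *)
Lemma shifted_off_closure :
  l2_closure m [set T f | f in supported_off] `<=` shifted_range C lambda.
Proof.
move=> g [lg gT].
have /choice[u uP] : forall n, exists u : F,
    supported_off u /\ (N (T u - g) <= (n.+1%:R^-1)%:E)%E.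
  move=> n; have [|_ [u uoff <-] un] := gT (n.+1%:R^-1); first by rewrite invr_gt0.
  by exists u.
have Tg : l2_cvg m (fun n => T (u n)) g.
  apply/l2_cvgP => // e /harmonic_le[n0 n0P]; exists n0 => n /n0P ne.
  by apply: le_trans (uP n).2 _; rewrite lee_fin.
have [f uf] : exists f, l2_cvg m u f.
  apply: l2_complete => // e e0.
  have [n0 n0P] := harmonic_le (divr_gt0 e0 (ltr0n R 4)).
  exists n0 => n k /n0P ne /n0P ke.
  have [[un_off un] [uk_off uk]] := (uP n, uP k).
  have off : supported_off (u n - u k).
    split; last first.
      by move=> x xK; rewrite -[LHS]/(u n x - u k x) un_off.2// uk_off.2// subr0.
    rewrite -scaleN1r; apply: finitely_supportedD; first exact: un_off.1.
    by apply: finitely_supportedZ; exact: uk_off.1.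
  apply: le_trans (coercive off) _.
  rewrite l2_sqnormBC in uk.
  have -> : T (u n - u k) = T (u n) - T (u k).
    by rewrite -scaleN1r shiftedD shiftedZ scaleN1r.
  apply: le_trans (l2_sqnorm_triangle m_gt0 un uk) _; rewrite lee_fin.
  by move: ne ke; move: (n.+1%:R^-1) (k.+1%:R^-1) => p q; lra.
have lf_ : l2 m f.
  apply: (l2_cvg_l2 m_gt0) uf => n; apply: finitely_supported_l2 => //.
  exact: (uP n).1.1.
(* The limit [f] is in the domain of the closure: Delta u_n = T u_n + lambda u_n converges to g +
   lambda f. *)
exists f, (g + lambda *: f); split; last by rewrite addrK.
split=> //; first by apply: l2D => //; exact: l2Z.
exists u; split => //; first by move=> n; exact: (uP n).1.1.
have -> : (fun n => L (u n)) = (fun n => T (u n) + lambda *: u n).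
  by apply/funext => n; rewrite subrK.
by apply: l2_cvgD => //; exact: l2_cvgZ.
Qed.

(** The range is identified with the closed space [add_span S0 w K]. It contains that space by
    [shifted_off_closure]; conversely, a range element is a limit of vectors T u_n, each of which
    splits into the image of a cutoff and a combination of the [w x]. *)
Lemma shifted_range_closed : l2_closed m (shifted_range C lambda).
Proof.
pose S0 := l2_closure m [set T f | f in supported_off].
pose w x := T (delta x).
have [SS cS] : l2_subspace m (add_span S0 w K) /\ l2_closed m (add_span S0 w K).
  apply: add_span_closed_subspace => //.
  - exact: l2_closure_subspace m_gt0 _ shifted_off_subspace.
  - exact: l2_closure_closed.
  - by move=> x; apply: shifted_l2; exact: delta_finitely_supported.
rewrite (_ : shifted_range C lambda = add_span S0 w K)//.
apply/seteqP; split; last first.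
  apply: add_span_sub; [exact: shifted_rangeD|exact: shifted_rangeZ| |].
    exact: shifted_off_closure.
  by move=> x; apply: shifted_rangeT; exact: delta_finitely_supported.
move=> _ [f [h [[lf_ lh [u [us uf uh]]] ->]]].
apply: (l2_closedP m _).1 cS _ _; split.
  by apply: l2B => //; exact: l2Z.
move=> e e0; have /l2_cvgP := l2_cvgB m_gt0 uh (l2_cvgZ m_gt0 lambda uf).
move=> /(_ m_gt0 e e0)[n0 /(_ n0 (leqnn _)) un0]; exists (T (u n0)) => //.
rewrite shifted_cutoff; apply: add_span_sum.
apply: sub_l2_closure; first by case: shifted_off_subspace.
by exists (cutoff (u n0)) => //; exact: cutoff_off.
Qed.

(** If the limit vanishes on [K], so do asymptotically the values there of an approximating
    sequence. Its cutoffs thus still converge to [f] while their images tend to 0, and coercivity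
    sends the cutoffs to 0. *)
Lemma shifted_kernel_inj f : shifted_kernel C lambda f ->
  (forall x, x \in K -> f x = 0) -> f = 0.
Proof.
move=> [h [lf_ lh [u [us uf uh]]] h0] fK.
have Tu0 : l2_cvg m (fun n => T (u n)) 0.
  by rewrite -h0; apply: l2_cvgB => //; exact: l2_cvgZ.
have decay (w : V -> F) : (forall x, l2 m (w x)) ->
    l2_cvg m (fun n => \sum_(x <- K) u n x *: w x) 0.
  move=> lw; apply: l2_cvg_sum0 => // x e xK e0.
  have [n0 n0P] := l2_cvg_at m_gt0 x uf e0; exists n0 => n /n0P.
  by rewrite fK// subr0.
have ld x : finitely_supported (delta x) by exact: delta_finitely_supported.
have Tw0 := l2_cvgB m_gt0 Tu0 (decay _ (fun x => shifted_l2 (ld x))).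
have wf := l2_cvgB m_gt0 uf (decay _ (fun x => finitely_supported_l2 m_gt0 (ld x))).
rewrite subr0 in wf; apply: (l2_cvg_unique m_gt0 wf).
apply/l2_cvgP => // e e0; have /(l2_cvgP m_gt0)/(_ e e0)[n0 n0P] := Tw0.
exists n0 => n /n0P; rewrite !subr0; apply: le_trans.
(* Both differences reduce to the cutoff of [u n] and to its image, where coercivity applies. *)
rewrite {1}(cutoff_decomp (u n)) addrK (shifted_cutoff (u n)) addrK.
exact: coercive (cutoff_off (us n)).
Qed.

Lemma notin_ess_spectrum : ~ ess_spectrum m C lambda.
Proof.
case=> [|]; first by apply; exact: shifted_range_closed.
apply: (@infinite_dimN _ _ _ K).
- exists 0; last by rewrite scaler0 subr0.
  rewrite -[X in C _ X]laplacian0; apply: laplacian_closure_core.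
  exact: finitely_supported0.
- exact: shifted_kernelD.
- exact: shifted_kernelZ.
- exact: shifted_kernel_inj.
Qed.

End LaplacianClosure.

(** * Choice of the finite set from the heavy ends and the Cheeger constant at infinity *)

Theorem corollary3p5 (R : realType) (V : countType) (G : wdigraph R V)
    (m : V -> R) (W : nat -> set V) :
  infinite_set [set: V] ->
  (forall x, 0 < m x) ->
  locally_finite G ->
  (forall x, 0 < beta_out G x) ->
  (forall x, 0 < beta_in G x) ->
  assumption_beta G ->
  connected_graph [set: V] (edges G) ->
  filtration G W ->
  min_degree_infty G m W = +oo%E ->
  (0 < cheeger_infty G W)%E ->
  ess_spectrum m (laplacian_closure G m) = set0.
Proof.
move=> _ m0 lf beta0 _ ab _ filW degW chW; rewrite -subset0 => lambda.
have [h [h0 [n1 n1P]]] : exists h : R, 0 < h /\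
    exists n1, forall n, (n1 <= n)%N -> (h%:E <= cheeger G (~` W n))%E.
  have [h h0 hl] : exists2 h : R, 0 < h & (h%:E < cheeger_infty G W)%E.
    (* Half of a finite limit, or 1 for an infinite one, lies strictly below the limit and hence
       eventually below the sequence. *)
    case: (cheeger_infty G W) chW => [r|_|//]; last by exists 1; rewrite ?ltry.
    by rewrite lte_fin => r0; exists (r / 2); rewrite ?lte_fin; lra.
  exists h; split => //.
  have [n1 _ n1P] := is_cvg_cheeger filW (open_ereal_gt' hl).
  by exists n1 => n /n1P/ltW.
(* Solves h^2 M / 8 = Re lambda + 1, the threshold of [laplacian_coercive]. *)
pose M := (complex.Re lambda + 1) / (h ^+ 2 / 8).
have [n2 n2P] : exists n2, forall n, (n2 <= n)%N ->
    (M%:E <= min_degree G m (~` W n))%E.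
  (* Monotonicity of the sequence makes [limn] a genuine limit, so heavy ends mean divergence to
     infinity. *)
  have /cvgeyPge/(_ M)[n2 _ n2P] : min_degree G m (~` W n) @[n --> \oo] --> +oo%E.
    by rewrite -degW; exact: is_cvg_min_degree filW.
  by exists n2.
have [Wf _ _ _] := filW; pose n := maxn n1 n2.
apply: (@notin_ess_spectrum _ _ _ _ m0 lf lambda (fset_set (W n))).
move=> f [ff fW]; apply: (@laplacian_coercive _ _ _ _ (~` W n) h M) => //.
- by apply: n1P; exact: leq_maxl.
- by apply: n2P; exact: leq_maxr.
- by rewrite /M mulrC divfK// gt_eqF// divr_gt0// exprn_gt0.
- move=> x fx Wx; move: fx; rewrite fW ?eqxx// in_fset_set//; exact: mem_set.
Qed.
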